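(* Let $T>0$ and let $\alpha,\gamma\in(0,1]$ with $\alpha+\gamma>1$. Let $X=(X_t)_{t\in[0,T]}$ be a stochastic process with $X\in BV_iC^{\alpha}$ and let $Y=(Y_t)_{t\in[0,T]}$ be a stochastic process (on the same probability space) with $Y\in C^{\gamma}([0,T])$. Then the integral $$\int_0^T X_s\,\mathrm{d}Y_s$$ exists almost surely in the generalized Lebesgue--Stieltjes sense.
   Context: $C^{\alpha}([0,T])$ is the space of Hölder continuous functions of order $\alpha$ on $[0,T]$; for a stochastic process $X$, $X\in C^\alpha([0,T])$ means that its sample paths belong to this space almost surely. $BV^{loc}$ is the space of functions $g:\mathbb{R}\to\mathbb{R}$ that are of bounded variation (bounded $1$-variation) over every compact subset of $\mathbb{R}$. Assumption (D) on a real-valued process $X=(X_t)_{t\in[0,T]}$: for almost every $t\in[0,T]$ the random variable $X_t$ has a density $p_t(y)$ (with respect to Lebesgue measure), and there exists $g\in L^1([0,T])$ such that $\sup_y p_t(y)\le g(t)$ for almost every $t\in[0,T]$. A process $Z$ belongs to $BV_iC^{\alpha}$ if it can be written as $Z_t=g(X_t)$, $t\in[0,T]$, for some (deterministic) $g\in BV^{loc}$ and some process $X\in C^\alpha([0,T])$ satisfying Assumption (D). Fractional Besov spaces, $0<\beta<1$: $W_1^\beta=W_1^\beta([0,T])$ is the space of measurable $f:[0,T]\to\mathbb{R}$ with $$\|f\|_{1,\beta}=\sup_{0\le s<t\le T}\left(\frac{|f(t)-f(s)|}{(t-s)^\beta}+\int_s^t\frac{|f(u)-f(s)|}{(u-s)^{1+\beta}}\,\mathrm{d}u\right)<\infty,$$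 and $W_2^\beta=W_2^\beta([0,T])$ is the space of measurable $f:[0,T]\to\mathbb{R}$ with $$\|f\|_{2,\beta}=\int_0^T\frac{|f(s)|}{s^\beta}\,\mathrm{d}s+\int_0^T\int_0^s\frac{|f(u)-f(s)|}{(s-u)^{1+\beta}}\,\mathrm{d}u\,\mathrm{d}s<\infty.$$ Generalized Lebesgue--Stieltjes integral: $\int_0^t f\,\mathrm{d}g$ (for $t\in(0,T]$) exists in the generalized Lebesgue--Stieltjes sense if there is $\beta\in(0,1)$ with $f\in W_2^\beta$ and $g\in W_1^{1-\beta}$; it is then defined as the Lebesgue integral $$\int_0^t f(s)\,\mathrm{d}g(s)=-\int_0^t (D^\beta_{0+}f)(s)\,(D^{1-\beta}_{t-}g_{t-})(s)\,\mathrm{d}s,$$ where $$(D^\beta_{0+}f)(s)=\frac{1}{\Gamma(1-\beta)}\left(\frac{f(s)}{s^\beta}+\beta\int_0^s\frac{f(s)-f(u)}{(s-u)^{\beta+1}}\,\mathrm{d}u\right),$$ $$(D^{1-\beta}_{t-}g_{t-})(s)=\frac{1}{\Gamma(\beta)}\left(\frac{g(s)-g(t)}{(t-s)^{1-\beta}}+(1-\beta)\int_s^t\frac{g(s)-g(u)}{(u-s)^{2-\beta}}\,\mathrm{d}u\right),$$ and the value does not depend on the choice of such $\beta$. *)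

(* Defs.v *)
From HB Require Import structures.
From mathcomp Require Import all_boot all_order all_algebra.
From mathcomp Require Import all_classical all_reals all_analysis.

Set Implicit Arguments.
Unset Strict Implicit.
Unset Printing Implicit Defensive.

Import Order.TTheory GRing.Theory Num.Theory.
Import numFieldNormedType.Exports.

Local Open Scope classical_set_scope.
Local Open Scope ring_scope.

(* Functions on [0, T] and processes indexed by [0, T] are represented by
   R-indexed families; no definition below depends on their values outside
   [0, T]. *)

Section Functions.
Context {R : realType}.
Local Notation leb := (@lebesgue_measure R).
Implicit Types (T a b t s : R) (f g : R -> R).

Definition holder T a f : Prop :=
  exists C : R, forall s t, s \in `[0, T] -> t \in `[0, T] ->
    `|f t - f s| <= C * `|t - s| `^ a.

Definition BVloc g : Prop := forall a b, a <= b -> bounded_variation a b g.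

Definition W1_norm T b f : \bar R :=
  ereal_sup [set x | exists s t, [/\ 0 <= s, s < t, t <= T &
    x = ((`|f t - f s| / (t - s) `^ b)%:E +
         \int[leb]_(u in `]s, t[) (`|f u - f s| / (u - s) `^ (1 + b))%:E)%E]].

Definition W1 T b f : Prop :=
  measurable_fun `[0, T] f /\ (W1_norm T b f < +oo)%E.

Definition W2_norm T b f : \bar R :=
  (\int[leb]_(s in `]0%R, T[) (`|f s| / s `^ b)%:E +
   \int[leb]_(s in `]0%R, T[) \int[leb]_(u in `]0%R, s[)
     (`|f u - f s| / (s - u) `^ (1 + b))%:E)%E.

Definition W2 T b f : Prop :=
  measurable_fun `[0, T] f /\ (W2_norm T b f < +oo)%E.

Definition Gamma (z : R) : R :=
  Rintegral leb `]0, +oo[ (fun x => x `^ (z - 1) * expR (- x)).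

(* D^b_{0+} f *)
Definition frac_deriv_left b f s : R :=
  (Gamma (1 - b))^-1 *
  (f s / s `^ b +
   b * Rintegral leb `]0, s[ (fun u => (f s - f u) / (s - u) `^ (b + 1))).

(* D^{1-b}_{t-} g_{t-}, as a function of the same b *)
Definition frac_deriv_right b t g s : R :=
  (Gamma b)^-1 *
  ((g s - g t) / (t - s) `^ (1 - b) +
   (1 - b) * Rintegral leb `]s, t[ (fun u => (g s - g u) / (u - s) `^ (2 - b))).

Definition gls_integrand b t f g s : R :=
  frac_deriv_left b f s * frac_deriv_right b t g s.

(* The integral of f against g over [0, t] exists in the generalized
   Lebesgue-Stieltjes sense and has value I. The integrability clause records
   that the defining integral is a genuine Lebesgue integral (Rintegral is
   total); it follows from membership in the two Besov spaces. *)
Definition is_gls_integral T t f g (I : R) : Prop :=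
  exists b : R, [/\ 0 < b < 1, W2 T b f, W1 T (1 - b) g,
    leb.-integrable `]0, t[ (EFin \o gls_integrand b t f g) &
    I = - Rintegral leb `]0, t[ (gls_integrand b t f g)].

Definition gls_integrable T t f g : Prop :=
  exists I : R, is_gls_integral T t f g I.

End Functions.

Section Processes.
Context {d : measure_display} {Omega : measurableType d} {R : realType}.
Variable P : probability Omega R.
Local Notation leb := (@lebesgue_measure R).

Definition holder_process (T a : R) (X : R -> {RV P >-> R}) : Prop :=
  {ae P, forall w, holder T a (fun t => X t w)}.

Definition has_density (X : {RV P >-> R}) (p : R -> R) : Prop :=
  [/\ measurable_fun [set: R] p, (forall y, 0 <= p y) &
      forall A : set R, measurable A ->
        distribution P X A = (\int[leb]_(y in A) (p y)%:E)%E].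

Definition assumptionD (T : R) (X : R -> {RV P >-> R}) : Prop :=
  exists p : R -> R -> R,
    {ae leb, forall t, t \in `[0, T] -> has_density (X t) (p t)} /\
    exists g : R -> R, leb.-integrable `[0, T] (EFin \o g) /\
      {ae leb, forall t, t \in `[0, T] ->
         (ereal_sup [set (p t y)%:E | y in [set: R]] <= (g t)%:E)%E}.

(* Equality of processes is indistinguishability on [0, T]. *)
Definition BViC (T a : R) (Z : R -> {RV P >-> R}) : Prop :=
  exists (g : R -> R) (X : R -> {RV P >-> R}),
    [/\ BVloc g, holder_process T a X, assumptionD T X &
        {ae P, forall w, forall t, t \in `[0, T] -> Z t w = g (X t w)}].

End Processes.

(* Main.v *)
Require Import Defs.
From HB Require Import structures.
From mathcomp Require Import all_boot all_order all_algebra.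
From mathcomp Require Import all_classical all_reals all_analysis.
From mathcomp Require Import measurable_realfun.
From mathcomp Require Import ring lra.

Import Order.TTheory GRing.Theory Num.Theory.
Import numFieldNormedType.Exports.

Local Open Scope classical_set_scope.
Local Open Scope ring_scope.

(** Fix an exponent b with 1 - gamma < b < alpha.  The theorem follows from three
    facts about almost every path.

    - Y lies in W_1^{1-b}: it is Holder of order gamma > 1 - b, so both terms of
      the norm are controlled by the integral of the power r^(gamma-(1-b)-1),
      which converges at 0 ([holder_W1]).

    - X lies in W_2^b.  Write X_s = g(xi_s), with xi Holder of order alpha.  On
      the event that xi is bounded by N and has Holder constant at most N, let v
      be the (bounded, nondecreasing) variation function of g on [-N, N].  With
      h = N r^alpha and r = s - u,
      |g(xi_u) - g(xi_s)| <= v(xi_s + h) - v(xi_s - h),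
      an upper bound in which u occurs only through r.  So the inner integral of
      the W_2^b norm is at most Phi(xi_s) for the deterministic function
      Phi(y) = int_0^T (v(y + N r^alpha) - v(y - N r^alpha)) r^(-1-b) dr.
      Since v is bounded by some V, translation invariance gives
      int_{-N}^N (v(y + h) - v(y - h)) dy <= 2 h V
      ([integral_increment_le]), hence Phi is integrable on [-N, N] because
      b < alpha ([increment_potential_lty]).  The density bound of Assumption (D)
      turns this into a bound on the expectation of the time integral of
      Phi(xi_s) 1_{|xi_s| <= N} over ]0, T[, which is therefore almost surely
      finite ([occupation_integral_finite]).  This holds for all integers N at
      once, and almost every path falls under one of them
      ([composition_W2]).

    - For f in W_2^b and g in W_1^{1-b} the left fractional derivative of f is
      integrable and the right fractional derivative of g is bounded, so their
      product is integrable ([gls_integrand_integrable]). *)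

(** * Isometries of the line and the integral of a power *)

Section lebesgue_isometries.
Context {R : realType}.
Local Notation leb := (@lebesgue_measure R).

(** Half-open intervals determine Lebesgue measure, so a map under which their
    preimages keep their length preserves it. *)
Lemma ge0_integral_isometry (phi : R -> R) (D : set R) (f : R -> \bar R) :
  measurable_fun setT phi ->
  (forall a b, leb (phi @^-1` `]a, b]%classic) = leb `]a, b]%classic) ->
  measurable D -> measurable_fun D f -> (forall x, (0 <= f x)%E) ->
  (\int[leb]_(x in phi @^-1` D) f (phi x) = \int[leb]_(x in D) f x)%E.
Proof.
move=> mphi phiE mD mf f0.
pose phi' : measurableTypeR R -> measurableTypeR R := phi.
have mphi' : measurable_fun setT phi' by [].
rewrite -[LHS](ge0_integral_pushforward mphi' leb) //.
apply: eq_measure_integral => A mA _; apply/esym.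
by apply: lebesgue_measure_unique => // _ [[a b]] _ <-; exact/esym/phiE.
Qed.

Lemma ge0_integral_shift (c : R) (D : set R) (f : R -> \bar R) :
  measurable D -> measurable_fun D f -> (forall x, (0 <= f x)%E) ->
  (\int[leb]_(x in (fun x => x + c)%R @^-1` D) f (x + c)%R
    = \int[leb]_(x in D) f x)%E.
Proof.
move=> mD mf f0; apply: ge0_integral_isometry => //.
  exact: measurable_funD.
move=> a b; rewrite (_ : _ @^-1` _ = `]a - c, b - c]%classic); last first.
  by apply/seteqP; split=> x /=; rewrite !in_itv/= ltrBlDr lerBrDr.
rewrite !lebesgue_measure_itv/= !lte_fin ltrD2r -!EFinD.
by case: ifP => // _; congr EFin; ring.
Qed.

Lemma ge0_integral_reflect (c : R) (D : set R) (f : R -> \bar R) :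
  measurable D -> measurable_fun D f -> (forall x, (0 <= f x)%E) ->
  (\int[leb]_(x in (fun x => c - x)%R @^-1` D) f (c - x)%R
    = \int[leb]_(x in D) f x)%E.
Proof.
move=> mD mf f0; apply: ge0_integral_isometry => //.
  exact: measurable_funB.
move=> a b; rewrite (_ : _ @^-1` _ = `[c - b, c - a[%classic); last first.
  by apply/seteqP; split=> x /=; rewrite !in_itv/= => /andP[? ?]; apply/andP; lra.
rewrite !lebesgue_measure_itv/= !lte_fin ltrD2l ltrN2 -!EFinD.
by case: ifP => // _; congr EFin; ring.
Qed.

Lemma ge0_integral_itv_shift (s t : R) (f : R -> \bar R) :
  measurable_fun setT f -> (forall x, (0 <= f x)%E) ->
  (\int[leb]_(u in `]s, t[) f (u - s)%R = \int[leb]_(r in `]0%R, (t - s)%R[) f r)%E.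
Proof.
move=> mf f0; rewrite -(ge0_integral_shift (- s) (`]0, (t - s)[)%classic) //; last exact: measurable_funTS.
congr (integral _ _ _); apply/seteqP; split=> x /=; rewrite !in_itv/= => /andP[? ?];
  apply/andP; lra.
Qed.

Lemma ge0_integral_itv_reflect (s : R) (f : R -> \bar R) :
  measurable_fun setT f -> (forall x, (0 <= f x)%E) ->
  (\int[leb]_(u in `]0%R, s[) f (s - u)%R = \int[leb]_(r in `]0%R, s[) f r)%E.
Proof.
move=> mf f0; rewrite -[RHS](ge0_integral_reflect s (`]0, s[)%classic) //; last exact: measurable_funTS.
congr (integral _ _ _); apply/seteqP; split=> x /=; rewrite !in_itv/= => /andP[? ?];
  apply/andP; lra.
Qed.

(** The primitive r^p / p is not differentiable at 0 when p < 1, so the fundamental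
    theorem of calculus is applied on [h / (n + 2), h] and n tends to infinity. *)
Lemma integral_powR_le (p h : R) : 0 < p -> 0 < h ->
  (\int[leb]_(r in `]0%R, h[) (r `^ (p - 1))%:E <= (h `^ p / p)%:E)%E.
Proof.
move=> p0 h0.
have mq (q : R) : measurable_fun setT (fun r : R => (r `^ q)%:E).
  by apply/measurable_EFinP; apply: measurable_powR.
pose a n : R := h / n.+2%:R.
have a0 n : 0 < a n by rewrite divr_gt0.
have ah n : a n < h by rewrite ltr_pdivrMr// ltr_pMr// ltr1n.
pose F n := `[a n, h]%classic.
have sub : `]0, h[%classic `<=` \bigcup_n F n.
  move=> x /=; rewrite in_itv/= => /andP[x0 xh].
  exists (Num.bound (h / x)) => //=.
  rewrite /F/= in_itv/= (ltW xh) andbT ler_pdivrMr// mulrC -ler_pdivrMr//.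
  have hx0 : 0 <= h / x by rewrite divr_ge0// ltW.
  rewrite (le_trans (ltW (archi_boundP hx0)))//.
  by rewrite ler_nat -addn2 leq_addr.
apply: (@le_trans _ _ (\int[leb]_(r in \bigcup_n F n) (r `^ (p - 1))%:E)%E).
  apply: ge0_subset_integral => //=.
  - by apply: bigcup_measurable => n _; exact: measurable_itv.
  - exact: measurable_funTS (mq _).
  - by move=> x _; rewrite lee_fin powR_ge0.
have nF : nondecreasing_seq F.
  move=> m n mn; rewrite subsetEset => x; rewrite /F/= !in_itv/= => /andP[ax ->].
  rewrite andbT (le_trans _ ax)// ler_pM2l// lef_pV2 ?posrE//.
  by rewrite ler_nat !ltnS.
have cvF := @ge0_nondecreasing_set_cvg_integral _ (measurableTypeR R) R F
  (fun r : R => (r `^ (p - 1))%:E) leb nF (fun=> measurable_itv _)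
  (fun n => measurable_funTS (mq _)) (fun i x _ => powR_ge0 _ _).
rewrite -(cvg_lim _ cvF)//; apply: lime_le; first by apply/cvg_ex; eexists; exact: cvF.
apply: nearW => n.
have cpow (q : R) : {in `[a n, h], continuous (fun r : R => r `^ q)}.
  move=> x /[!in_itv]/= /andP[ax _]; apply/differentiable_continuous.
  apply/derivable1_diffP; apply: derivable_powR.
  by rewrite in_itv/= andbT (lt_le_trans (a0 n)).
rewrite (@continuous_FTC2 _ _ (fun r => p^-1 * r `^ p)) //.
- by rewrite -EFinB lee_fin mulrC lerBlDr lerDl mulr_ge0 ?powR_ge0// invr_ge0 ltW.
- apply: continuous_in_subspaceT => x xa; apply: cpow.
  by rewrite inE in xa.
- split.
  + move=> x /[!in_itv]/= /andP[ax _]; apply: derivableM => //.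
    by apply: derivable_powR; rewrite in_itv/= andbT (lt_trans (a0 n)).
  + apply: cvg_at_right_filter; apply: cvgM; first exact: cvg_cst.
    by apply: cpow; rewrite in_itv/= lexx ltW.
  + apply: cvg_at_left_filter; apply: cvgM; first exact: cvg_cst.
    by apply: cpow; rewrite in_itv/= lexx ltW.
- move=> x /[!in_itv]/= /andP[ax _].
  have x0 : 0 < x by rewrite (lt_trans (a0 n)).
  rewrite derive1E deriveM//; last by apply: derivable_powR; rewrite in_itv/= andbT.
  rewrite derive_cst scaler0 addr0 -derive1E powR_derive1 ?in_itv/= ?andbT//.
  by rewrite /GRing.scale/= mulrA mulVf ?mul1r// gt_eqF.
Qed.

End lebesgue_isometries.

(** * Integrals that depend on a parameter *)

Section measurable_sections.
Context {d : measure_display} {X : measurableType d} {R : realType}.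
Local Notation leb := (@lebesgue_measure R).
Implicit Types (c : X -> R -> bool).

(** Tonelli's theorem gives measurability of integrals over a fixed domain; the
    fractional derivatives integrate over an interval that moves with the
    parameter, which is absorbed into the integrand as an indicator. *)
Lemma measurable_ge0_integral_section c (k : X -> R -> \bar R) :
  measurable_fun [set: X * R] (fun p => c p.1 p.2) ->
  measurable_fun [set: X * R] (fun p => k p.1 p.2) ->
  (forall x u, (0 <= k x u)%E) ->
  measurable_fun [set: X] (fun x => \int[leb]_(u in [set u | c x u]) k x u)%E.
Proof.
move=> mc mk k0.
pose k' (p : X * R) := if c p.1 p.2 then k p.1 p.2 else 0%E.
have mk' : measurable_fun setT k' by exact: measurable_fun_ifT.
have k'0 p : (0 <= k' p)%E by rewrite /k'; case: ifP.
rewrite (_ : (fun x => _) = fubini_F leb k').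
  exact: measurable_fun_fubini_tonelli_F.
apply/funext => x; rewrite integral_mkcond /fubini_F.
by apply: eq_integral => u _; rewrite patchE mem_setE.
Qed.

Lemma measurable_Rintegral_section c (k : X -> R -> R) :
  measurable_fun [set: X * R] (fun p => c p.1 p.2) ->
  measurable_fun [set: X * R] (fun p => k p.1 p.2) ->
  measurable_fun [set: X] (fun x => Rintegral leb [set u | c x u] (k x)).
Proof.
move=> mc mk; apply: measurableT_comp => //.
under eq_fun do rewrite integralE.
have mk' : measurable_fun [set: X * R] (fun p => (k p.1 p.2)%:E).
  exact/measurable_EFinP.
apply: emeasurable_funB; apply: measurable_ge0_integral_section => //.
- by under eq_fun do rewrite funeposE; exact: measurable_maxe.
- under eq_fun do rewrite funenegE; apply: measurable_maxe => //.
  exact: measurableT_comp.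
Qed.

End measurable_sections.

Section tonelli.
Context {d1 d2 : measure_display} {X : measurableType d1} {Y : measurableType d2}.
Context {R : realType}.

(** Tonelli's theorem on a rectangle, reduced to the whole product by extending the
    integrand by 0. *)
Lemma tonelli_setX (m1 : {sigma_finite_measure set X -> \bar R})
    (m2 : {sigma_finite_measure set Y -> \bar R})
    (A : set X) (B : set Y) (f : X -> Y -> \bar R) :
  measurable A -> measurable B ->
  measurable_fun setT (fun p : X * Y => f p.1 p.2) ->
  (forall x y, (0 <= f x y)%E) ->
  (\int[m1]_(x in A) \int[m2]_(y in B) f x y =
   \int[m2]_(y in B) \int[m1]_(x in A) f x y)%E.
Proof.
move=> mA mB mf f0.
pose F (p : X * Y) : \bar R := ((fun p => f p.1 p.2) \_ (A `*` B)) p.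
have mF : measurable_fun setT F.
  by apply: ((measurable_restrictT _ (measurableX mA mB)).1 _); exact: measurable_funTS.
have F0 p : (0 <= F p)%E by apply: erestrict_ge0 => q _.
transitivity (\int[m1]_x \int[m2]_y F (x, y))%E.
  rewrite integral_mkcond; apply: eq_integral => x _.
  rewrite patchE; case: ifPn => xA.
    rewrite integral_mkcond; apply: eq_integral => y _.
    by rewrite /F !patchE in_setX xA.
  rewrite (_ : (fun y => _) = cst 0%E) ?integral0//.
  by apply/funext => y; rewrite /F patchE in_setX (negbTE xA).
rewrite fubini_tonelli// [RHS]integral_mkcond; apply: eq_integral => y _.
rewrite patchE; case: ifPn => yB.
  rewrite [RHS]integral_mkcond; apply: eq_integral => x _.
  by rewrite /F !patchE in_setX yB andbT.
rewrite (_ : (fun x => _) = cst 0%E) ?integral0//.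
by apply/funext => x; rewrite /F patchE in_setX (negbTE yB) andbF.
Qed.

End tonelli.

(** * Measurability and size of the fractional derivatives *)

Section fractional_derivatives.
Context {R : realType}.
Local Notation leb := (@lebesgue_measure R).
Implicit Types (T b s : R) (f g : R -> R).

Lemma measurable_powR_comp d (X : measurableType d) (h : X -> R) (q : R) :
  measurable_fun setT h -> measurable_fun setT (fun x => h x `^ q).
Proof. by move=> mh; exact: (measurableT_comp (measurable_powR q)). Qed.

Lemma measurable_powRV d (X : measurableType d) (h : X -> R) (q : R) :
  measurable_fun setT h -> measurable_fun setT (fun x => (h x `^ q)^-1).
Proof.
by move=> mh; under eq_fun do rewrite -powRN; exact: measurable_powR_comp.
Qed.

Lemma measurable_itv_section (a1 a2 : R -> R) :
  measurable_fun setT a1 -> measurable_fun setT a2 ->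
  measurable_fun [set: R * R] (fun p => a1 p.1 < p.2 < a2 p.1).
Proof.
move=> m1 m2; apply: measurable_and; apply: measurable_fun_ltr => //.
- exact: (measurableT_comp m1).
- exact: (measurableT_comp m2).
Qed.

(** Paths are only known to be measurable on [0, T]; the measurability lemmas for
    sections require a function that is measurable everywhere. *)
Lemma measurable_extension T f : measurable_fun `[0, T] f ->
  exists2 f' : R -> R, measurable_fun setT f' &
    forall s, 0 <= s <= T -> f s = f' s.
Proof.
move=> mf; exists (f \_ `[0, T]).
  exact: ((measurable_restrictT _ (measurable_itv _)).1 _).
by move=> s s0T; rewrite patchE mem_setE in_itv/= s0T.
Qed.

Lemma measurable_frac_deriv_left T b f : measurable_fun `[0, T] f ->
  measurable_fun `]0, T[ (frac_deriv_left b f).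
Proof.
move=> /measurable_extension[f' mf' ff'].
apply: (@eq_measurable_fun _ _ _ _ _ (frac_deriv_left b f')).
  move=> s /[!inE]/= /[!in_itv]/= /andP[s0 sT].
  rewrite /frac_deriv_left ff' ?ltW//; congr (_ * (_ + _ * _)).
  apply: eq_Rintegral => u /[!inE]/= /[!in_itv]/= /andP[u0 us].
  by rewrite ff' // (ltW u0) (ltW (lt_trans us sT)).
apply: measurable_funTS; apply: measurable_funM => //.
apply: measurable_funD.
  apply: measurable_funM => //; exact: measurable_powRV.
apply: measurable_funM => //.
apply: (@measurable_Rintegral_section _ _ _ (fun s u => 0 < u < s)
  (fun s u => (f' s - f' u) / (s - u) `^ (b + 1))).
  exact: (@measurable_itv_section (fun=> 0) id).
apply: measurable_funM.
  by apply: measurable_funB; exact: (measurableT_comp mf').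
by apply: measurable_powRV; exact: measurable_funB.
Qed.

Lemma measurable_frac_deriv_right T b g : measurable_fun `[0, T] g ->
  measurable_fun `]0, T[ (frac_deriv_right b T g).
Proof.
move=> /measurable_extension[g' mg' gg'].
apply: (@eq_measurable_fun _ _ _ _ _ (frac_deriv_right b T g')).
  move=> s /[!inE]/= /[!in_itv]/= /andP[s0 sT].
  rewrite /frac_deriv_right !gg' ?lexx ?(ltW s0) ?(ltW sT) ?(ltW (lt_trans s0 sT))//.
  congr (_ * (_ + _ * _)).
  apply: eq_Rintegral => u /[!inE]/= /[!in_itv]/= /andP[su uT].
  by rewrite gg' // (ltW uT) (ltW (lt_trans s0 su)).
apply: measurable_funTS; apply: measurable_funM => //.
apply: measurable_funD.
  apply: measurable_funM => //; first exact: measurable_funB.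
  by apply: measurable_powRV; exact: measurable_funB.
apply: measurable_funM => //.
apply: (@measurable_Rintegral_section _ _ _ (fun s u => s < u < T)
  (fun s u => (g' s - g' u) / (u - s) `^ (2 - b))).
  exact: (@measurable_itv_section id (fun=> T)).
apply: measurable_funM.
  by apply: measurable_funB; exact: (measurableT_comp mg').
by apply: measurable_powRV; exact: measurable_funB.
Qed.

(** When the extended integral is infinite its real value is 0 by convention;
    otherwise this is the triangle inequality. *)
Lemma normr_Rintegral_le D (k : R -> R) (h : R -> R) :
  measurable D -> measurable_fun D k -> (forall u, D u -> `|k u| = h u) ->
  (`|Rintegral leb D k|%:E <= \int[leb]_(u in D) (h u)%:E)%E.
Proof.
move=> mD mk kh.
have -> : (\int[leb]_(u in D) (h u)%:E = \int[leb]_(u in D) `|(k u)%:E|)%E.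
  by apply: eq_integral => u /[!inE] Du; rewrite -kh.
apply: le_trans (le_abse_integral _ _ _) => //; last exact/measurable_EFinP.
by rewrite /Rintegral; case: (integral _ _ _) => [r| |] //=; rewrite normr0 leey.
Qed.

(** Since b < 1 the factor b in front of the integral is dropped, which leaves
    exactly the integrand of the W_2^b norm. *)
Lemma frac_deriv_left_le T b f s : 0 < b < 1 -> measurable_fun `[0, T] f ->
  0 < s < T ->
  (`|frac_deriv_left b f s|%:E <= `|(Gamma (1 - b))^-1|%:E *
    ((`|f s| / s `^ b)%:E +
     \int[leb]_(u in `]0%R, s[) (`|f u - f s| / (s - u) `^ (1 + b))%:E))%E.
Proof.
move=> /andP[b0 b1] mf /andP[s0 sT].
rewrite /frac_deriv_left normrM EFinM lee_wpmul2l//.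
set B := Rintegral _ _ _.
apply: (@le_trans _ _ (`|f s / s `^ b|%:E + `|b * B|%:E)%E).
  by rewrite -EFinD lee_fin ler_normD.
rewrite normrM normfV (ger0_norm (powR_ge0 _ _)) leeD// normrM EFinM.
rewrite (gtr0_norm b0).
apply: (@le_trans _ _ (1%:E * `|B|%:E)%E); first by rewrite -!EFinM lee_fin ler_wpM2r// ltW.
rewrite mul1e; apply: normr_Rintegral_le => //.
- apply: measurable_funM.
    apply: measurable_funB => //; apply: measurable_funS mf => //.
    by move=> u /=; rewrite !in_itv/= => /andP[u0 us]; rewrite !ltW// (lt_trans us).
  by apply: measurable_funTS; apply: measurable_powRV; exact: measurable_funB.
- move=> u _; rewrite normrM normfV (ger0_norm (powR_ge0 _ _)) distrC.
  by rewrite [1 + b]addrC.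
Qed.

(** The supremum defining the W_1^{1-b} norm is evaluated at the pair (s, T); the
    factor 1 - b < 1 in front of the integral is dropped. *)
Lemma frac_deriv_right_le T b g s : 0 < b < 1 -> W1 T (1 - b) g -> 0 < s < T ->
  (`|frac_deriv_right b T g s|%:E <=
    `|(Gamma b)^-1|%:E * W1_norm T (1 - b) g)%E.
Proof.
move=> /andP[b0 b1] [mg _] /andP[s0 sT].
rewrite /frac_deriv_right normrM EFinM lee_wpmul2l//.
apply: (@le_trans _ _ ((`|g T - g s| / (T - s) `^ (1 - b))%:E +
         \int[leb]_(u in `]s, T[) (`|g u - g s| / (u - s) `^ (1 + (1 - b)))%:E)%E); last first.
  by apply: ereal_sup_ubound; exists s, T; split => //; exact: ltW.
set B := Rintegral _ _ _.
apply: (@le_trans _ _ (`|(g s - g T) / (T - s) `^ (1 - b)|%:E + `|(1 - b) * B|%:E)%E).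
  by rewrite -EFinD lee_fin ler_normD.
rewrite normrM normfV (ger0_norm (powR_ge0 _ _)) distrC leeD// normrM EFinM.
rewrite (@gtr0_norm _ (1 - b)) ?subr_gt0//.
apply: (@le_trans _ _ (1%:E * `|B|%:E)%E).
  by rewrite -!EFinM lee_fin ler_wpM2r// gerBl ltW.
rewrite mul1e; apply: normr_Rintegral_le => //.
- apply: measurable_funM.
    apply: measurable_funB => //; apply: measurable_funS mg => //.
    by move=> u /=; rewrite !in_itv/= => /andP[su uT]; rewrite !ltW// (lt_trans s0).
  by apply: measurable_funTS; apply: measurable_powRV; exact: measurable_funB.
- move=> u _; rewrite normrM normfV (ger0_norm (powR_ge0 _ _)) distrC.
  by rewrite addrA.
Qed.

Lemma measurable_W2_inner T b f : measurable_fun `[0, T] f ->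
  measurable_fun `]0, T[ (fun s => \int[leb]_(u in `]0%R, s[)
    (`|f u - f s| / (s - u) `^ (1 + b))%:E)%E.
Proof.
move=> /measurable_extension[f' mf' ff'].
pose k (s u : R) : \bar R := (`|f' u - f' s| / (s - u) `^ (1 + b))%:E.
have mk : measurable_fun setT (fun s => \int[leb]_(u in [set u | (0 < u < s)%R]) k s u)%E.
  apply: measurable_ge0_integral_section.
  - exact: (@measurable_itv_section (fun=> 0) id).
  - apply/measurable_EFinP; apply: measurable_funM.
      apply: measurableT_comp => //.
      by apply: measurable_funB; exact: (measurableT_comp mf').
    by apply: measurable_powRV; exact: measurable_funB.
  - by move=> s u; rewrite /k lee_fin divr_ge0// powR_ge0.
apply: eq_measurable_fun (measurable_funTS mk).
move=> s /[!inE]/= /[!in_itv]/= /andP[s0 sT].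
apply: eq_integral => u /[!inE]/= /andP[u0 us].
by rewrite /k !ff' // ?(ltW u0) ?(ltW s0) ltW ?(lt_trans us sT).
Qed.

Lemma W1_norm_ge0 T b f : 0 < T -> (0 <= W1_norm T b f)%E.
Proof.
move=> T0; apply: le_ereal_sup_tmp; eexists; first by exists 0, T.
rewrite adde_ge0 ?lee_fin ?divr_ge0 ?powR_ge0//.
by apply: integral_ge0 => u _; rewrite lee_fin divr_ge0 ?powR_ge0.
Qed.

(** The integrand is an integrable factor times a bounded one: integrating
    [frac_deriv_left_le] over ]0, T[ gives the W_2^b norm of f, and
    [frac_deriv_right_le] is uniform in s. *)
Lemma gls_integrand_integrable T b f g : 0 < T -> 0 < b < 1 ->
  W2 T b f -> W1 T (1 - b) g ->
  leb.-integrable `]0, T[ (EFin \o gls_integrand b T f g).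
Proof.
move=> T0 b01 [mf f2] W1g; have [mg g1] := W1g.
have mL := @measurable_frac_deriv_left _ b _ mf.
have mR := @measurable_frac_deriv_right _ b _ mg.
have L_le s := @frac_deriv_left_le T b f s b01 mf.
have R_le s := @frac_deriv_right_le T b g s b01 W1g.
have mI := @measurable_W2_inner T b f mf.
move: mL mR L_le R_le mI f2.
rewrite /gls_integrand /W2_norm.
(* From here on only the measurability of the two fractional derivatives and the
   bounds [L_le] and [R_le] matter. *)
move: (frac_deriv_left b f) (frac_deriv_right b T g) => L D.
pose cL : R := `|(Gamma (1 - b))^-1|; pose cR : R := `|(Gamma b)^-1|.
have : 0 <= cL by exact: normr_ge0.
have : 0 <= cR by exact: normr_ge0.
rewrite -/cL -/cR; move: cL cR => cL cR cR0 cL0.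
have := W1_norm_ge0 T (1 - b) g T0; move: g1.
case: (W1_norm _ _ _) => [M _|//|//]; rewrite lee_fin => M0.
move=> mL mR L_le R_le.
pose I (s : R) : \bar R := (\int[leb]_(u in `]0%R, s[) (`|f u - f s| / (s - u) `^ (1 + b))%:E)%E.
rewrite -/I => mI f2.
have mLD : measurable_fun `]0, T[ (fun s => L s * D s) := measurable_funM mL mR.
apply/integrableP; split; first exact/measurable_EFinP.
pose A (s : R) : \bar R := (`|f s| / s `^ b)%:E.
have A0 s : (0 <= A s)%E by rewrite lee_fin divr_ge0// powR_ge0.
have I0 s : (0 <= I s)%E.
  by apply: integral_ge0 => u _; rewrite lee_fin divr_ge0// powR_ge0.
have mA : measurable_fun `]0, T[ A.
  apply/measurable_EFinP; apply: measurable_funM.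
    apply: measurableT_comp => //; apply: measurable_funS mf => //.
    exact: subset_itv_oo_cc.
  by apply: measurable_funTS; apply: measurable_powRV.
have mAI : measurable_fun `]0, T[ (A \+ I)%E by exact: emeasurable_funD.
have AI_lty : (\int[leb]_(s in `]0%R, T[) (A s + I s) < +oo)%E.
  by rewrite ge0_integralD//.
have cM0 : 0 <= cL * (cR * M) by rewrite !mulr_ge0.
apply: (@le_lt_trans _ _ (\int[leb]_(s in `]0%R, T[) ((cL * (cR * M))%:E * (A s + I s)))%E).
  apply: ge0_le_integral => //.
  - exact/measurableT_comp/measurable_EFinP.
  - exact: measurable_funeM.
  - move=> s /=; rewrite in_itv/= => s0T.
    rewrite normrM EFinM [cL * _]mulrC EFinM -muleA muleC lee_pmul//.
      exact: R_le.
    exact: L_le.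
rewrite ge0_integralZl//; last by move=> s _; rewrite adde_ge0.
by rewrite lte_mul_pinfty.
Qed.

End fractional_derivatives.

(** * Holder paths *)

Section holder_paths.
Context {R : realType}.
Local Notation leb := (@lebesgue_measure R).
Implicit Types (T a l r t s : R) (f y : R -> R).

Definition clamp (l r t : R) : R := Num.min r (Num.max l t).

Lemma clamp_itv l r t : l <= r -> l <= clamp l r t <= r.
Proof.
by move=> lr; rewrite /clamp le_min lr le_max lexx ge_min lexx.
Qed.

Lemma clamp_id l r t : l <= t <= r -> clamp l r t = t.
Proof.
by move=> /andP[lt tr]; rewrite /clamp (max_idPr lt) (min_idPr tr).
Qed.

Lemma clamp_nondecreasing l r : nondecreasing_fun (clamp l r).
Proof. by move=> s t st; apply: le_min2 => //; exact: le_max2. Qed.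

Lemma clamp_lipschitz l r t s : l <= r ->
  `|clamp l r t - clamp l r s| <= `|t - s|.
Proof.
move=> lr; rewrite /clamp /Num.min /Num.max.
by do 4 case: ifP; rewrite ?ler_norml; do ?move=> /negbT; rewrite -?leNgt => *;
  have := ler_norm (t - s); have := ler_norm (s - t); rewrite [`|s - t|]distrC => *;
  apply/andP; split; lra.
Qed.

(** Paths are unconstrained outside [0, T]; freezing time at the endpoints extends
    the Holder bound to the whole line without changing the path on [0, T]. *)
Lemma holder_clamp T a f : 0 <= T -> 0 <= a -> holder T a f ->
  exists2 C, 0 <= C & forall s t,
    `|f (clamp 0 T t) - f (clamp 0 T s)| <= C * `|t - s| `^ a.
Proof.
move=> T0 a0 [C fC]; exists `|C| => // s t.
apply: (le_trans (fC _ _ _ _)); rewrite ?in_itv/= ?clamp_itv//.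
apply: (@le_trans _ _ (`|C| * `|clamp 0 T t - clamp 0 T s| `^ a)).
  by rewrite ler_wpM2r ?powR_ge0 ?ler_norm.
by rewrite ler_wpM2l// ge0_ler_powR ?nnegrE// clamp_lipschitz.
Qed.

Lemma holder_continuous C a f : 0 <= C -> 0 < a ->
  (forall s t, `|f t - f s| <= C * `|t - s| `^ a) -> continuous f.
Proof.
move=> C0 a0 fC s; apply/cvgrPdist_le => e e0.
have C1 : 0 < C + 1 by lra.
have eC : 0 < e / (C + 1) by rewrite divr_gt0.
apply/nbhs_ballP; exists ((e / (C + 1)) `^ a^-1); first by rewrite /= powR_gt0.
move=> t /=; rewrite /ball/= => st; rewrite distrC.
apply: (le_trans (fC _ _)).
apply: (@le_trans _ _ ((C + 1) * (e / (C + 1)))); last by rewrite mulrC divfK ?gt_eqF.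
rewrite ler_pM ?powR_ge0//; first lra.
move: (e / (C + 1)) eC st => z z0 st.
rewrite -[leRHS]powRr1 ?(ltW z0)// -(mulVf (lt0r_neq0 a0)) powRrM.
rewrite ge0_ler_powR ?nnegrE ?powR_ge0 ?(ltW a0)//.
by rewrite distrC ltW.
Qed.

Lemma holder_measurable T a f : 0 <= T -> 0 < a -> holder T a f ->
  measurable_fun `[0, T] f.
Proof.
move=> T0 a0 /(holder_clamp _ _ _ T0 (ltW a0))[C C0 fC].
have /continuous_measurable_fun mf : continuous (f \o clamp 0 T).
  exact: (@holder_continuous C a).
apply: (@eq_measurable_fun _ _ _ _ _ (f \o clamp 0 T)).
  by move=> t /[!inE]/= /[!in_itv]/= t0T; rewrite clamp_id.
exact: measurable_funTS mf.
Qed.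

(** Both terms of the norm are at most a multiple of (t - s)^(a-q): the first
    directly, the second after integrating C r^(a-q-1) over ]0, t - s[. *)
Lemma holder_W1 T a (q : R) y : 0 < T -> 0 < q < a -> holder T a y ->
  W1 T q y.
Proof.
move=> T0 /andP[q0 qa] hy; have a0 : 0 < a := lt_trans q0 qa.
have my := holder_measurable _ _ _ (ltW T0) a0 hy.
split=> //.
have [C C0 yC] := holder_clamp _ _ _ (ltW T0) (ltW a0) hy.
have aq : 0 < a - q by rewrite subr_gt0.
pose K : R := C * T `^ (a - q) + C * (T `^ (a - q) / (a - q)).
apply: (@le_lt_trans _ _ K%:E); last exact: ltry.
apply: ub_ereal_sup => _ [s [t [s0 st tT ->]]].
have yst u : s < u <= t -> `|y u - y s| <= C * (u - s) `^ a.
  move=> /andP[su ut]; have := yC s u.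
  rewrite (clamp_id 0 T u); last by rewrite (le_trans s0 (ltW su)) (le_trans ut).
  rewrite (clamp_id 0 T s); last by rewrite s0 (le_trans (ltW st)).
  by rewrite (@gtr0_norm _ (u - s)) ?subr_gt0.
have ts0 : 0 < t - s by rewrite subr_gt0.
have tsT : (t - s) `^ (a - q) <= T `^ (a - q).
  by rewrite ge0_ler_powR ?nnegrE ?(ltW aq) ?(ltW ts0) ?(ltW T0)//; lra.
rewrite /K EFinD leeD//.
  rewrite lee_fin ler_pdivrMr ?powR_gt0//.
  apply: (le_trans (yst t _)); first by rewrite st lexx.
  rewrite -mulrA ler_wpM2l//.
  rewrite -[in leLHS](subrK q a) (@powRD _ (t - s) (a - q) q); last first.
    by rewrite (gt_eqF ts0) implybT.
  by rewrite ler_wpM2r ?powR_ge0.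
apply: (@le_trans _ _ (\int[leb]_(u in `]s, t[) (C%:E * ((u - s) `^ ((a - q) - 1))%:E))%E).
  apply: ge0_le_integral => //.
  - by move=> u _; rewrite lee_fin divr_ge0 ?powR_ge0.
  - apply/measurable_EFinP; apply: measurable_funM.
      apply: measurableT_comp => //; apply: measurable_funB => //.
      apply: measurable_funS my => // u /=; rewrite !in_itv/= => /andP[su ut].
      by rewrite (le_trans s0 (ltW su)) (le_trans (ltW ut)).
    by apply: measurable_funTS; apply: measurable_powRV; exact: measurable_funB.
  - apply: measurable_funeM; apply/measurable_EFinP.
    by apply: measurable_funTS; apply: measurable_powR_comp; exact: measurable_funB.
  - move=> u /=; rewrite in_itv/= => /andP[su ut].
    have us0 : 0 < u - s by rewrite subr_gt0.
    rewrite lee_fin ler_pdivrMr ?powR_gt0// -mulrA -powRD; last first.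
      by rewrite (gt_eqF us0) implybT.
    have -> : a - q - 1 + (1 + q) = a by ring.
    by apply: yst; rewrite su ltW.
rewrite ge0_integralZl//; last 2 first.
- apply/measurable_EFinP.
  by apply: measurable_funTS; apply: measurable_powR_comp; exact: measurable_funB.
- by move=> u _; rewrite lee_fin powR_ge0.
rewrite EFinM lee_wpmul2l//.
rewrite (ge0_integral_itv_shift s t (fun r : R => (r `^ (a - q - 1))%:E))//; last 2 first.
- by apply/measurable_EFinP; exact: measurable_powR.
- by move=> r; rewrite lee_fin powR_ge0.
apply: (le_trans (integral_powR_le _ _ aq ts0)).
by rewrite lee_fin ler_wpM2r// invr_ge0 ltW.
Qed.

End holder_paths.

(** * Increments of a function of bounded variation *)

Section variation.
Context {R : realType}.
Local Notation leb := (@lebesgue_measure R).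
Implicit Types (g v : R -> R) (M N V h T a b : R).

(** Here v plays the role of the distribution function of the variation measure of g
    on [-N, N]. *)
Definition increments_dominated N g v : Prop :=
  forall y z : R, - N <= y -> y <= z -> z <= N -> `|g z - g y| <= v z - v y.

(** Take for v the total variation of g from -M, frozen outside [-M, M] so that it is
    monotone and bounded on the whole line; V is the total variation on [-M, M]. *)
Lemma BVloc_majorant g M : 0 <= M -> BVloc g ->
  exists v V, [/\ nondecreasing_fun v, forall y, 0 <= v y <= V &
    increments_dominated M g v].
Proof.
move=> M0 bvg.
pose k := clamp (- M) M.
have kM y : - M <= k y <= M by apply: clamp_itv; lra.
have knd y z : y <= z -> k y <= k z by exact: clamp_nondecreasing.
pose tv (x y : R) : \bar R := total_variation x y g.
have tvfin x y : x <= y -> tv x y \is a fin_num.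
  by move=> xy; apply/bounded_variationP => //; exact: bvg.
have tvD x y z : x <= y -> y <= z -> fine (tv x z) = fine (tv x y) + fine (tv y z).
  by move=> xy yz; rewrite /tv (total_variationD g xy yz) fineD// tvfin.
have tv0 x y : x <= y -> 0 <= fine (tv x y).
  by move=> xy; rewrite fine_ge0// total_variation_ge0.
pose v y := fine (tv (- M) (k y)).
exists v, (fine (tv (- M) M)); split.
- move=> y z /knd kyz; have /andP[My _] := kM y.
  by rewrite /v (tvD _ _ _ My kyz) lerDl tv0.
- move=> y; have /andP[My yM] := kM y.
  by rewrite tv0// (tvD _ _ _ My yM) lerDl tv0.
- move=> y z My yz zM.
  have kid u : - M <= u <= M -> k u = u by exact: clamp_id.
  rewrite /v !kid ?My ?zM ?(le_trans My yz) ?(le_trans yz zM)//.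
  rewrite (tvD _ _ _ My yz) addrAC.
  rewrite subrr add0r -lee_fin fineK ?tvfin//; exact: total_variation_ge.
Qed.

(** By translation the two integrals are those of v over [-N + h, N + h] and
    [-N - h, N - h]; the first interval exceeds the second by at most
    ]N - h, N + h], on which v is at most V. *)
Lemma integral_increment_le v N V h : nondecreasing_fun v ->
  (forall y, 0 <= v y <= V) -> 0 <= N -> 0 <= h ->
  (\int[leb]_(y in `[(- N)%R, N]) (v (y + h) - v (y - h))%:E <= (2 * h * V)%:E)%E.
Proof.
move=> vnd vV N0 h0.
have v0 y : 0 <= v y by have /andP[] := vV y.
have vle y : v y <= V by have /andP[] := vV y.
have mv : measurable_fun setT v by exact: nondecreasing_measurable.
have mvc (c : R) : measurable_fun setT (fun y : R => v (y + c)).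
  by apply: (measurableT_comp mv); exact: measurable_funD.
have mev : measurable_fun setT (EFin \o v) by exact/measurable_EFinP.
have shift c : (\int[leb]_(y in `[(- N)%R, N]) (v (y + c))%:E =
    \int[leb]_(y in `[(- N + c)%R, (N + c)%R]) (v y)%:E)%E.
  rewrite -[RHS](ge0_integral_shift c _ (EFin \o v))//; last first.
    by apply: measurable_funTS.
  congr (integral _ _ _); apply/seteqP; split=> y /=; rewrite !in_itv/= => /andP[? ?];
    apply/andP; lra.
set B := (\int[leb]_(y in `[(- N)%R, N]) (v (y + - h))%:E)%E.
have Bfin : B \is a fin_num.
  rewrite ge0_fin_numE; last by apply: integral_ge0 => y _; rewrite lee_fin.
  apply: (@le_lt_trans _ _ (\int[leb]_(y in `[(- N)%R, N]) V%:E)%E).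
    apply: ge0_le_integral => //; last by move=> y _; rewrite lee_fin.
    - by move=> y _; rewrite lee_fin.
    - by apply/measurable_EFinP; apply: measurable_funTS; exact: mvc.
  rewrite integral_cst//= lebesgue_measure_itv/=; case: ifP => _.
    by rewrite -EFinB -EFinM ltry.
  by rewrite mule0.
have AB : (\int[leb]_(y in `[(- N)%R, N]) (v (y + h))%:E <= B + (2 * h * V)%:E)%E.
  rewrite /B !shift.
  apply: (@le_trans _ _ (\int[leb]_(y in `[(- N - h)%R, (N - h)%R] `|`
      `](N - h)%R, (N + h)%R]) (v y)%:E)%E).
    apply: ge0_subset_integral => //=.
    - exact: measurableU.
    - exact: (measurable_funTS mev).
    - by move=> y _; rewrite lee_fin.
    - move=> y /=; rewrite !in_itv/= => /andP[y1 y2].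
      by have [yN|yN] := leP y (N - h); [left|right]; apply/andP; lra.
  rewrite ge0_integral_setU//=; last 3 first.
  - exact: (measurable_funTS mev).
  - by move=> y _; rewrite lee_fin.
  - apply/disj_setPS => y /=; rewrite !in_itv/= => -[/andP[_ y1] /andP[y2 _]]; lra.
  rewrite leeD2l//.
  apply: (@le_trans _ _ (\int[leb]_(y in `](N - h)%R, (N + h)%R]) V%:E)%E).
    apply: ge0_le_integral => //; last by move=> y _; rewrite lee_fin.
    - by move=> y _; rewrite lee_fin.
    - exact: (measurable_funTS mev).
  rewrite integral_cst//= lebesgue_measure_itv/=; case: ifP => _.
    by rewrite -EFinB -EFinM lee_fin; lra.
  by rewrite mule0 lee_fin !mulr_ge0// (le_trans (v0 0)).
move: AB; rewrite (_ : (\int[leb]_(y in _) (v (y + h))%:E)%E =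
    (B + \int[leb]_(y in `[(- N)%R, N]) (v (y + h) - v (y - h))%:E)%E).
  by rewrite leeD2lE.
rewrite /B -ge0_integralD//.
- by apply: eq_integral => y _; rewrite -EFinD; congr EFin; ring.
- by move=> y _; rewrite lee_fin.
- by apply/measurable_EFinP; apply: measurable_funTS; exact: mvc.
- by move=> y _; rewrite lee_fin subr_ge0 vnd//; lra.
- by apply/measurable_EFinP; apply: measurable_funTS; apply: measurable_funB; exact: mvc.
Qed.

(** With y = x_s this bounds the integrand of the W_2^b norm of g(x) at lag r, when v
    dominates the increments of g and |x_{s-r} - x_s| <= N r^a. *)
Definition increment_kernel N a b v (y r : R) : R :=
  (v (y + N * r `^ a) - v (y - N * r `^ a)) / r `^ (1 + b).

Definition increment_potential T N a b v (y : R) : \bar R :=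
  (\int[leb]_(r in `]0%R, T[) (increment_kernel N a b v y r)%:E)%E.

Lemma increment_kernel_ge0 N a b v y r : 0 <= N -> nondecreasing_fun v ->
  0 <= increment_kernel N a b v y r.
Proof.
move=> N0 vnd; have Nr0 : 0 <= N * r `^ a by rewrite mulr_ge0 ?powR_ge0.
by rewrite divr_ge0 ?powR_ge0// subr_ge0 vnd//; lra.
Qed.

Lemma measurable_increment_kernel N a b v : nondecreasing_fun v ->
  measurable_fun setT (fun p : R * R => (increment_kernel N a b v p.1 p.2)%:E).
Proof.
move=> vnd; have mv : measurable_fun setT v by exact: nondecreasing_measurable.
have mN : measurable_fun setT (fun p : R * R => N * p.2 `^ a).
  by apply: measurable_funM => //; exact: measurable_powR_comp.
apply/measurable_EFinP; apply: measurable_funM; last exact: measurable_powRV.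
by apply: measurable_funB; apply: (measurableT_comp mv);
  [exact: measurable_funD|exact: measurable_funB].
Qed.

Lemma increment_potential_ge0 T N a b v y : 0 <= N -> nondecreasing_fun v ->
  (0 <= increment_potential T N a b v y)%E.
Proof.
move=> N0 vnd; apply: integral_ge0 => r _.
by rewrite lee_fin increment_kernel_ge0.
Qed.

Lemma measurable_increment_potential T N a b v : 0 <= N ->
  nondecreasing_fun v -> measurable_fun setT (increment_potential T N a b v).
Proof.
move=> N0 vnd.
apply: (measurable_ge0_integral_section (fun (y : R) r => 0 < r < T)
  (fun y r => (increment_kernel N a b v y r)%:E)).
- exact: (@measurable_itv_section _ (fun=> 0) (fun=> T)).
- exact: measurable_increment_kernel.
- by move=> y r; rewrite lee_fin increment_kernel_ge0.
Qed.

(** Integrating in y first, [integral_increment_le] with h = N r^a leaves the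
    integral of 2 N V r^(a-b-1) over ]0, T[, which is finite since b < a. *)
Lemma increment_potential_lty T N V a b v : 0 < T -> 0 < b < a -> 0 <= N ->
  nondecreasing_fun v -> (forall y, 0 <= v y <= V) ->
  (\int[leb]_(y in `[(- N)%R, N]) increment_potential T N a b v y < +oo)%E.
Proof.
move=> T0 /andP[b0 ba] N0 vnd vV.
pose F (y r : R) : \bar R := (increment_kernel N a b v y r)%:E.
have mv : measurable_fun setT v by exact: nondecreasing_measurable.
have mF : measurable_fun setT (fun p : R * R => F p.1 p.2).
  exact: measurable_increment_kernel.
have Nr0 r : 0 <= N * r `^ a by rewrite mulr_ge0 ?powR_ge0.
have F0 y r : (0 <= F y r)%E by rewrite lee_fin increment_kernel_ge0.
rewrite (tonelli_setX leb leb _ _ F)//.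
have ab0 : 0 < a - b by rewrite subr_gt0.
have V0 : 0 <= V by have /andP[v0 v1] := vV 0; exact: le_trans v1.
have mp : measurable_fun setT (fun r : R => (r `^ (a - b - 1))%:E).
  by apply/measurable_EFinP; exact: measurable_powR.
apply: (@le_lt_trans _ _
  (\int[leb]_(r in `]0%R, T[) ((2 * N * V)%:E * (r `^ (a - b - 1))%:E))%E).
  apply: ge0_le_integral => //.
  - by move=> r _; apply: integral_ge0 => y _; exact: F0.
  - apply: measurable_funTS.
    apply: (measurable_ge0_integral_section (fun (r y : R) => - N <= y <= N)
      (fun r y => F y r)) => //.
      by apply: measurable_and; apply: measurable_fun_ler.
    exact: (measurableT_comp mF (@measurable_swap _ _ R R)).
  - by apply: measurable_funeM; exact: measurable_funTS.
  - move=> r /=; rewrite in_itv/= => /andP[r0 rT].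
    rewrite /F /increment_kernel; under eq_integral do rewrite EFinM.
    rewrite ge0_integralZr//; last 3 first.
    + apply: measurable_funTS; apply/measurable_EFinP.
      by apply: measurable_funB; apply: (measurableT_comp mv);
        [exact: measurable_funD|exact: measurable_funB].
    + by move=> y _; rewrite lee_fin subr_ge0 vnd//; have := Nr0 r; lra.
    + by rewrite lee_fin invr_ge0 powR_ge0.
    apply: (le_trans (lee_wpmul2r _ (integral_increment_le _ _ V _ vnd vV N0 (Nr0 r)))).
      by rewrite lee_fin invr_ge0 powR_ge0.
    rewrite -!EFinM lee_fin -[in leLHS](subrK 1 a).
    have -> : a - b - 1 = a - (1 + b) by ring.
    rewrite (powRD (s := - (1 + b))); last by rewrite (gt_eqF r0) implybT.
    by rewrite powRN subrK; lra.
rewrite ge0_integralZl//; last 3 first.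
- exact: measurable_funTS.
- by move=> r _; rewrite lee_fin powR_ge0.
- by rewrite lee_fin !mulr_ge0.
rewrite lte_mul_pinfty ?lee_fin ?mulr_ge0//.
exact: le_lt_trans (integral_powR_le _ _ ab0 T0) (ltry _).
Qed.

End variation.

(** * Time integrals along a process with bounded densities *)

Section occupation.
Context {d : measure_display} {Omega : measurableType d} {R : realType}.
Local Notation leb := (@lebesgue_measure R).

(** The process is the pointwise limit of its values at the grid points
    floor(t (n + 1)) / (n + 1), and each such discretization is measurable because
    the grid is countable. *)
Lemma measurable_continuous_process (f : R -> Omega -> R) :
  (forall t, measurable_fun setT (f t)) -> (forall w, continuous (f^~ w)) ->
  measurable_fun setT (fun p : Omega * R => f p.2 p.1).
Proof.
move=> mf cf.
pose c (n : nat) : R := n.+1%:R.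
have c0 n : 0 < c n by rewrite ltr0n.
pose h (n : nat) (p : Omega * R) : R := f ((Num.floor (p.2 * c n))%:~R / c n) p.1.
apply: (@measurable_fun_cvg _ _ R setT h).
- move=> n _ B mB; rewrite setTI.
  have -> : h n @^-1` B = \bigcup_(k : int)
      ([set p : Omega * R | k%:~R <= p.2 * c n < (k + 1)%:~R] `&`
       [set p : Omega * R | B (f (k%:~R / c n) p.1)]).
    apply/seteqP; split=> p /=.
      move=> Bp; exists (Num.floor (p.2 * c n)) => //; split => //=.
      exact: floor_itv.
    by move=> [k _ [/floor_def /= <-]].
  apply: countable_bigcupT_measurable => // k; apply: measurableI.
    have mk : measurable_fun setT
        (fun p : Omega * R => k%:~R <= p.2 * c n < (k + 1)%:~R).
      apply: measurable_and; [apply: measurable_fun_ler|apply: measurable_fun_ltr] => //;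
        exact: measurable_funM.
    by have := mk measurableT [set true]; rewrite setTI; exact.
  have mk : measurable_fun setT (fun p : Omega * R => f (k%:~R / c n) p.1).
    exact: (measurableT_comp (mf _)).
  by have := mk measurableT B mB; rewrite setTI.
- move=> [w t] _; rewrite /h/=.
  apply: (@cvg_comp _ _ _ (fun n => (Num.floor (t * c n))%:~R / c n) (f^~ w) \oo (nbhs t));
    last exact: cf.
  apply/cvgrPdist_le => e e0; near=> n.
  have /andP[fl1 fl2] := floor_itv (t * c n).
  set k := Num.floor (t * c n) in fl1 fl2 *.
  apply: (@le_trans _ _ (c n)^-1).
    rewrite -[t in leLHS](mulfK (lt0r_neq0 (c0 n))) -mulrBl normrM.
    rewrite [X in _ * X]gtr0_norm ?invr_gt0// ler_piMl ?invr_ge0 ?(ltW (c0 n))//.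
    rewrite ger0_norm ?subr_ge0// lerBlDl; apply: ltW.
    by move: fl2; rewrite intrD.
  have : `|0 - @harmonic R n| <= e by near: n; apply: cvgr_dist_le => //; exact: cvg_harmonic.
  by rewrite distrC subr0 ger0_norm ?harmonic_ge0.
Unshelve. all: by end_near. Qed.

Variable P : probability Omega R.

(** The law of X is dominated by c times Lebesgue measure. *)
Lemma density_expectation_le (X : {RV P >-> R}) (p : R -> R) (c : R)
    (chi : R -> \bar R) :
  has_density X p -> (forall y, p y <= c) ->
  measurable_fun setT chi -> (forall y, (0 <= chi y)%E) ->
  (\int[P]_w chi (X w) <= c%:E * \int[leb]_y chi y)%E.
Proof.
move=> [mp p0 pX] pc mchi chi0.
have c0 : 0 <= c := le_trans (p0 0) (pc 0).
(* The law is taken on the measurable space that carries Lebesgue measure, so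
   that the two measures can be compared. *)
pose X0 : Omega -> measurableTypeR R := X.
have mX0 : measurable_fun [set: Omega] X0 by exact: (measurable_funPT X).
pose mixX0 := isMeasurableFun.Build _ _ Omega (measurableTypeR R) X0 mX0.
pose X' : {mfun Omega >-> measurableTypeR R} := HB.pack X0 mixX0.
rewrite -[leLHS](ge0_integral_distribution X' mchi chi0).
rewrite -[leRHS](ge0_integral_mscale leb measurableT (NngNum c0) mchi)//.
apply: ge0_le_measure_integral => // A mA.
rewrite -[leLHS]/(distribution P X A) pX// /mscale/=.
apply: (@le_trans _ _ (\int[leb]_(y in A) c%:E)%E); last by rewrite integral_cst.
apply: ge0_le_integral => //.
- by move=> y _; rewrite lee_fin.
- by apply/measurable_EFinP; exact: measurable_funTS.
- by move=> y _; rewrite lee_fin.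
Qed.

(** The expectation of the time integral of chi(X_s) is at most the integral of the
    density bound times the space integral of chi, by Tonelli's theorem.  To have
    joint measurability, X is replaced by a process xi all of whose paths are
    continuous: it is frozen outside [0, T] and set to 0 on a null set. *)
Lemma occupation_integral_finite (T a : R) (X : R -> {RV P >-> R})
    (chi : R -> \bar R) : 0 < T -> 0 < a ->
  holder_process T a X -> assumptionD T X ->
  measurable_fun setT chi -> (forall y, (0 <= chi y)%E) ->
  (\int[leb]_y chi y < +oo)%E ->
  {ae P, forall w, (\int[leb]_(s in `]0%R, T[) chi (X s w) < +oo)%E}.
Proof.
move=> T0 a0 [Z [mZ PZ subZ]] [p [denp [g [ig supp]]]] mchi chi0 chi_lty.
have hX w : ~ Z w -> holder T a (fun t => X t w).
  by move=> nZw; apply: contrapT => nh; exact: nZw (subZ _ nh).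
pose xi (t : R) (w : Omega) : R := \1_(~` Z) w * X (clamp 0 T t) w.
have xiE w t : ~ Z w -> t \in `]0, T[ -> xi t w = X t w.
  move=> nZw; rewrite in_itv/= => /andP[t0 tT].
  by rewrite /xi indicE mem_set// mul1r clamp_id// !ltW.
have mxi : measurable_fun setT (fun q : Omega * R => xi q.2 q.1).
  apply: measurable_continuous_process.
    move=> t; apply: measurable_funM => //.
    by apply: measurable_indic; exact: measurableC.
  move=> w; have [Zw|nZw] := pselect (Z w).
    rewrite (_ : xi^~ w = cst 0); first by move=> t; exact: cvg_cst.
    by apply/funext => t; rewrite /xi indicE memNset ?mul0r// => /(_ Zw).
  have [C C0 XC] := holder_clamp _ _ _ (ltW T0) (ltW a0) (hX w nZw).
  apply: (@holder_continuous _ C a) => // s t.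
  by rewrite /xi indicE mem_set// !mul1r.
have mchixi : measurable_fun setT (fun q : Omega * R => chi (xi q.2 q.1)).
  exact: (measurableT_comp mchi).
have fin : (\int[P]_w \int[leb]_(s in `]0%R, T[) chi (xi s w) < +oo)%E.
  rewrite (tonelli_setX P leb setT _ (fun w s => chi (xi s w)))//.
  pose K := (\int[leb]_y chi y)%E.
  have K0 : (0 <= K)%E by apply: integral_ge0.
  have ig' : leb.-integrable `]0, T[ (EFin \o g).
    by apply: integrableS ig => //; exact: subset_itv_oo_cc.
  have /integrableP[mg g_lty] := ig'.
  apply: (@le_lt_trans _ _ (\int[leb]_(s in `]0%R, T[) (`|(g s)%:E| * K))%E).
    apply: ae_ge0_le_integral => //.
    - by move=> s _; apply: integral_ge0.
    - apply: measurable_funTS.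
      have := measurable_fun_fubini_tonelli_G (m1 := P) _ mchixi.
      by apply => q.
    - by move=> s _; rewrite mule_ge0.
    - by apply: emeasurable_funM => //; exact: measurableT_comp.
    - move: denp supp; apply: (@filterS2 _ _ (ae_filter_ringOfSetsType leb)) => s dens sups; rewrite /= in_itv/= => s0T.
      have s0T' : s \in `[0, T].
        by move: s0T; rewrite in_itv/= => /andP[? ?]; rewrite !ltW.
      have pg y : p s y <= g s.
        by rewrite -lee_fin (le_trans _ (sups s0T'))//; apply: ereal_sup_ubound; exists y.
      rewrite (_ : (\int[P]_w chi (xi s w))%E = (\int[P]_w chi (X s w))%E); last first.
        apply: ge0_ae_eq_integral => //.
        + apply: (measurableT_comp mchi).
          exact: (measurable_fun_pair1 s mxi).
        + exact: (measurableT_comp mchi).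
        + exists Z; split => // w /= nE; apply: contrapT => nZw; apply: nE => _.
          by rewrite xiE.
      apply: (le_trans (density_expectation_le (X s) (p s) (g s) chi (dens s0T') pg mchi chi0)).
      by rewrite lee_wpmul2r// lee_fin ler_norm.
  rewrite ge0_integralZr//; last exact: measurableT_comp.
  by rewrite lte_mul_pinfty ?ge0_fin_numE ?integral_ge0.
have : P.-integrable setT (fun w => \int[leb]_(s in `]0%R, T[) chi (xi s w))%E.
  apply/integrableP; split.
    apply: (measurable_ge0_integral_section (fun (w : Omega) s => 0 < s < T)
      (fun w s => chi (xi s w))) => //.
    by apply: measurable_and; apply: measurable_fun_ltr.
  under eq_integral do rewrite gee0_abs ?integral_ge0//.
  exact: fin.
move=> /(integrable_ae measurableT); have : {ae P, forall w, ~ Z w}.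
  by exists Z; split => // w /= /contrapT.
apply: filterS2 => w nZw /(_ I).
rewrite ge0_fin_numE ?integral_ge0//.
suff -> : (\int[leb]_(s in `]0%R, T[) chi (xi s w) =
  \int[leb]_(s in `]0%R, T[) chi (X s w))%E by [].
by apply: eq_integral => s /[!inE]/= s0T; rewrite xiE.
Qed.

End occupation.

(** * Besov regularity of the composition *)

Section composition.
Context {R : realType}.
Local Notation leb := (@lebesgue_measure R).
Implicit Types (T N V a b : R) (g v x z : R -> R).

(** On [-N, N], g = v - (v - g) is a difference of nondecreasing functions. *)
Lemma increments_dominated_measurable N g v : 0 <= N -> nondecreasing_fun v ->
  increments_dominated N g v ->
  measurable_fun `[- N, N] g.
Proof.
move=> N0 vnd gv.
pose k := clamp (- N) N.
have kN y : - N <= k y <= N by apply: clamp_itv; lra.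
have knd (y z : R) : y <= z -> k y <= k z by exact: clamp_nondecreasing.
have mvk : measurable_fun setT (v \o k).
  by apply: nondecreasing_measurable => // y z yz; apply/vnd/knd.
have mvgk : measurable_fun setT (fun y => v (k y) - g (k y)).
  apply: nondecreasing_measurable => // y z /knd kyz.
  have /andP[Ny _] := kN y; have /andP[_ zN] := kN z.
  by have := gv _ _ Ny kyz zN; have := ler_norm (g (k z) - g (k y)); lra.
apply: (@eq_measurable_fun _ _ _ _ _ (fun y => v (k y) - (v (k y) - g (k y)))).
  move=> y /[!inE]/= /[!in_itv]/= yN.
  by rewrite /k clamp_id//; ring.
by apply: measurable_funTS; exact: measurable_funB.
Qed.

(** For r = s - u, the points x_u and x_s both lie in
    [x_s - N r^a, x_s + N r^a], so |z_u - z_s| is at most the increment of v over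
    that interval; the inner integral of the W_2^b norm at s is then at most the
    potential at x_s.  The term with |z_s| / s^b is finite because z is bounded and
    b < 1. *)
Lemma composition_W2 T N V a b g v x z : 0 < T -> 0 < b < a -> b < 1 -> 0 <= N ->
  nondecreasing_fun v -> (forall y, 0 <= v y <= V) ->
  increments_dominated N g v ->
  measurable_fun `[0, T] x ->
  (forall t, t \in `[0, T] -> `|x t| <= N) ->
  (forall s t, s \in `[0, T] -> t \in `[0, T] -> `|x t - x s| <= N * `|t - s| `^ a) ->
  (\int[leb]_(s in `]0%R, T[) increment_potential T N a b v (x s) < +oo)%E ->
  (forall t, t \in `[0, T] -> z t = g (x t)) ->
  W2 T b z.
Proof.
move=> T0 bba b1 N0 vnd vV gv mx xN xH potfin zE.
have /andP[b0 ba] := bba.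
have mz : measurable_fun `[0, T] z.
  apply: (@eq_measurable_fun _ _ _ _ _ (g \o x)).
    by move=> t /[!inE]/= t0T; rewrite zE.
  apply: (@measurable_comp _ _ _ _ _ _ `[- N, N]) => //.
  - by move=> _ [t /= t0T <-] /=; rewrite in_itv/= -ler_norml xN.
  - exact: increments_dominated_measurable gv.
split => //; rewrite /W2_norm.
have gz y w : `|y| <= N -> `|w| <= N -> `|g y - g w| <= `|v y - v w|.
  move=> yN' wN'; have /andP[Ny yN] : - N <= y <= N by rewrite -ler_norml.
  have /andP[Nw wN] : - N <= w <= N by rewrite -ler_norml.
  have [yw|/ltW wy] := leP y w.
    by rewrite (distrC (g y)) (distrC (v y)) (le_trans (gv _ _ Ny yw wN))// ler_norm.
  by rewrite (le_trans (gv _ _ Nw wy yN))// ler_norm.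
have v0 y : 0 <= v y by have /andP[] := vV y.
have V0 : 0 <= V by have /andP[_] := vV 0; exact: le_trans (v0 0).
have zK s : s \in `[0, T] -> `|z s| <= `|g 0| + V.
  move=> s0T; rewrite zE// -[g (x s)](subrK (g 0)) addrC (le_trans (ler_normD _ _))//.
  rewrite lerD2l (le_trans (gz _ _ (xN _ s0T) _)) ?normr0//.
  have /andP[? ?] := vV (x s); have /andP[? ?] := vV 0.
  by rewrite ler_norml; apply/andP; lra.
have oocc s : 0 < s < T -> s \in `[0, T].
  by rewrite in_itv/= => /andP[? ?]; rewrite !ltW.
apply: lte_add_pinfty.
  pose K : R := `|g 0| + V.
  have K0 : 0 <= K by rewrite addr_ge0.
  have mp : measurable_fun `]0, T[ (fun s : R => (s `^ ((1 - b) - 1))%:E).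
    by apply/measurable_EFinP; apply: measurable_funTS; exact: measurable_powR.
  apply: (@le_lt_trans _ _ (\int[leb]_(s in `]0%R, T[) (K%:E * (s `^ ((1 - b) - 1))%:E))%E).
    apply: ge0_le_integral => //.
    - by move=> s _; rewrite lee_fin divr_ge0 ?powR_ge0.
    - apply/measurable_EFinP; apply: measurable_funM.
        apply: measurableT_comp => //; apply: measurable_funS mz => //.
      by apply: measurable_funTS; apply: measurable_powRV.
    - exact: measurable_funeM.
    - move=> s /=; rewrite in_itv/= => s0T.
      rewrite -EFinM lee_fin (_ : 1 - b - 1 = - b); last by ring.
      by rewrite powRN ler_wpM2r ?invr_ge0 ?powR_ge0// zK// oocc.
  rewrite ge0_integralZl//; last first.
    by move=> s _; rewrite lee_fin powR_ge0.
  rewrite lte_mul_pinfty//.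
  apply: le_lt_trans (ltry _); apply: integral_powR_le => //; lra.
apply: le_lt_trans potfin.
have mpot := measurable_increment_potential T N a b v N0 vnd.
apply: ge0_le_integral.
- exact: measurable_itv.
- move=> s _; apply: integral_ge0 => u _.
  by rewrite lee_fin divr_ge0 ?powR_ge0.
- exact: measurable_W2_inner.
- apply: (measurableT_comp mpot); apply: measurable_funS mx => //.
move=> s /=; rewrite in_itv/= => s0T; have /andP[s0 sT] := s0T.
(* For fixed s the substitution r = s - u turns the bound on the inner integral
   into part of the potential at the point x s. *)
pose F (r : R) : \bar R := (increment_kernel N a b v (x s) r)%:E.
have F0 r : (0 <= F r)%E by rewrite lee_fin increment_kernel_ge0.
have mF : measurable_fun setT F.
  exact: (measurable_fun_pair2 (x s) (measurable_increment_kernel N a b v vnd)).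
apply: (@le_trans _ _ (\int[leb]_(u in `]0%R, s[) F (s - u)%R)%E).
  apply: ge0_le_integral => //.
  - by move=> u _; rewrite lee_fin divr_ge0 ?powR_ge0.
  - apply/measurable_EFinP; apply: measurable_funM.
      apply: measurableT_comp => //; apply: measurable_funB => //.
      apply: measurable_funS mz => // u /=; rewrite !in_itv/= => /andP[u0 us].
      by rewrite (ltW u0) ltW// (lt_trans us).
    by apply: measurable_funTS; apply: measurable_powRV; exact: measurable_funB.
  - by apply: measurable_funTS; apply: (measurableT_comp mF); exact: measurable_funB.
  - move=> u /=; rewrite in_itv/= => /andP[u0 us].
    have u0T : 0 < u < T by rewrite u0 (lt_trans us).
    rewrite lee_fin ler_wpM2r ?invr_ge0 ?powR_ge0// !zE ?oocc//.
    apply: (le_trans (gz _ _ (xN _ (oocc _ u0T)) (xN _ (oocc _ s0T)))).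
    have := xH _ _ (oocc _ s0T) (oocc _ u0T).
    rewrite distrC [`|u - s|]distrC (@gtr0_norm _ (s - u)) ?subr_gt0//.
    set h := N * _; rewrite distrC !ler_norml => /andP[h1 h2].
    have h0 : 0 <= h by rewrite mulr_ge0 ?powR_ge0.
    have v1 : v (x s - h) <= v (x u) by apply: vnd; lra.
    have v2 : v (x u) <= v (x s + h) by apply: vnd; lra.
    have v3 : v (x s - h) <= v (x s) by apply: vnd; lra.
    have v4 : v (x s) <= v (x s + h) by apply: vnd; lra.
    by apply/andP; lra.
rewrite ge0_integral_itv_reflect//.
apply: ge0_subset_integral => //.
- exact: measurable_funTS mF.
- by move=> r /=; rewrite !in_itv/= => /andP[-> rs]; rewrite (lt_trans rs).
Qed.

End composition.

(** * The integral exists *)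

Theorem theorem3p2 (d : measure_display) (Omega : measurableType d)
    (R : realType) (P : probability Omega R) (T alpha gamma : R)
    (hT : 0 < T) (halpha : 0 < alpha <= 1) (hgamma : 0 < gamma <= 1)
    (hsum : 1 < alpha + gamma)
    (X Y : R -> {RV P >-> R})
    (hX : BViC T alpha X) (hY : holder_process T gamma Y) :
  {ae P, forall w, gls_integrable T T (fun t => X t w) (fun t => Y t w)}.
Proof.
have /andP[alpha0 alpha1] := halpha; have /andP[gamma0 gamma1] := hgamma.
have [g [xi [bvg hxi dxi XE]]] := hX.
have [b [gb ba]] : exists b : R, 1 - gamma < b /\ b < alpha.
  by exists ((1 - gamma + alpha) / 2); split; lra.
have b01 : 0 < b < 1 by apply/andP; split; lra.
have b0a : 0 < b < alpha by apply/andP; split; lra.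
have /andP[b0 b1] := b01.
(* Whether chi is integrable along a path is decided for all integers n outside one
   null set; the n that bounds a given path is chosen afterwards. *)
pose chi (n : nat) (v : R -> R) : R -> \bar R :=
  increment_potential T n%:R alpha b v \_ `[- n%:R, n%:R].
have occ (n : nat) : {ae P, forall w, exists v V,
    [/\ nondecreasing_fun v, forall y, 0 <= v y <= V,
     increments_dominated n%:R g v &
     (\int[lebesgue_measure]_(s in `]0%R, T[) chi n v (xi s w) < +oo)%E]}.
  have n0 : 0 <= n%:R :> R by [].
  have [v [V [vnd vV gv]]] := BVloc_majorant g n%:R n0 bvg.
  have mpot := measurable_increment_potential T n%:R alpha b v n0 vnd.
  have potfin := increment_potential_lty _ _ _ _ _ v hT b0a n0 vnd vV.
  have /= : {ae P, forall w, (\int[lebesgue_measure]_(s in `]0%R, T[) chi n v (xi s w) < +oo)%E}.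
    apply: (occupation_integral_finite P T alpha xi) => //.
    - by apply: ((measurable_restrictT _ (measurable_itv _)).1 _); exact: measurable_funTS.
    - by move=> y; apply: erestrict_ge0 => {}y _; exact: increment_potential_ge0.
    - by rewrite -integral_mkcond.
  by apply: filterS => w fin; exists v, V.
have paths : {ae P, forall w, holder T alpha (fun t => xi t w) /\
    holder T gamma (fun t => Y t w)}.
  by move: hxi hY; apply: filterS2.
move: paths XE (ae_foralln occ); apply: filterS3 => w [hx hy] Xw occw.
have W1Y : W1 T (1 - b) (fun t => Y t w).
  by apply: (holder_W1 T gamma) => //; apply/andP; split; lra.
have [C C0 xC] := holder_clamp _ _ _ (ltW hT) (ltW alpha0) hx.
pose x t := xi t w.
have xH s t : s \in `[0, T] -> t \in `[0, T] ->
    `|x t - x s| <= C * `|t - s| `^ alpha.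
  by rewrite !in_itv/= => s0T t0T; have := xC s t; rewrite !clamp_id.
(* This n bounds both the path and its Holder constant. *)
pose n := Num.bound (C + `|x 0| + C * T `^ alpha).
have CT0 : 0 <= C * T `^ alpha by rewrite mulr_ge0 ?powR_ge0.
have Cn : C + `|x 0| + C * T `^ alpha <= n%:R.
  by apply/ltW/archi_boundP; rewrite !addr_ge0.
have n0 : 0 <= n%:R :> R by [].
have x0 := normr_ge0 (x 0).
have xn t : t \in `[0, T] -> `|x t| <= n%:R.
  move=> t0T; have /xH/(_ t0T) : 0 \in `[0, T] by rewrite in_itv/= lexx ltW.
  have : C * `|t - 0| `^ alpha <= C * T `^ alpha.
    move: t0T; rewrite in_itv/= => /andP[t0 tT].
    by rewrite ler_wpM2l// ge0_ler_powR ?nnegrE ?subr0 ?ger0_norm ?(ltW alpha0) ?(ltW hT).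
  have := ler_normD (x t - x 0) (x 0); rewrite subrK; lra.
have [v [V [vnd vV gv occn]]] := occw n.
have W2X : W2 T b (fun t => X t w).
  apply: (composition_W2 T n%:R V alpha b g v x) => //.
  - exact: (holder_measurable T alpha _ (ltW hT) alpha0 hx).
  - move=> s t s0T t0T; apply: (le_trans (xH _ _ s0T t0T)).
    by rewrite ler_wpM2r ?powR_ge0//; lra.
  - suff -> : (\int[lebesgue_measure]_(s in `]0%R, T[)
        increment_potential T n%:R alpha b v (x s) =
      \int[lebesgue_measure]_(s in `]0%R, T[) chi n v (xi s w))%E by [].
    apply: eq_integral => s /[!inE]/= s0T.
    rewrite /chi patchE mem_set//= in_itv/= -ler_norml xn//.
    by move: s0T; rewrite !in_itv/= => /andP[? ?]; rewrite !ltW.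
exists (- Rintegral lebesgue_measure `]0, T[
  (gls_integrand b T (fun t => X t w) (fun t => Y t w))).
by exists b; split => //; exact: gls_integrand_integrable.
Qed.
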